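(* Let $\mathcal A=\mathcal A(\Sigma)$ be a cluster algebra, $H\le\mathrm{Aut}\,\mathcal A$, and let $\mathcal A(\Sigma_1)$ be a cluster subalgebra of $\mathcal A$ which is maximal (under inclusion) among cluster subalgebras of $\mathcal A$ contained in $\mathcal A^H$. (i) If $\mathcal A^H=\mathcal A(\Sigma_1)$, then the orbit $Hz$ is infinite for every $z\in\mathcal A\setminus\mathcal A(\Sigma_1)$ which can be written as a Laurent polynomial with positive coefficients in the variables of some cluster. (ii) Conversely, $\mathcal A^H=\mathcal A(\Sigma_1)$ holds if either (a) $\mathcal A$ has a stable monomial basis with unique expression and $|Hz|=+\infty$ for every cluster variable $z\in\mathcal A\setminus\mathcal A(\Sigma_1)$; or (b) $\mathcal A$ has a $\mathcal D$-stable basis and $|Hz|=+\infty$ for every cluster variable or quasi cluster variable $z\in\mathcal A\setminus\mathcal A(\Sigma_1)$.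
   Context: Cluster algebras: a seed is $\Sigma=(\mathbf x_{ex},\mathbf x_{fr},\widetilde B)$ with exchange variables $\mathbf x_{ex}$ and frozen variables $\mathbf x_{fr}$, $\widetilde B$ an $m\times n$ integer matrix with skew-symmetrizable upper part; $\mathcal A(\Sigma)$ is the $\mathbb Q$-algebra generated by all cluster variables of seeds mutation-equivalent to $\Sigma$; $\mathcal X$ denotes the set of all cluster variables, $R$ the polynomial ring over $\mathbb Q$ in the frozen variables. A cluster automorphism is an algebra automorphism mapping some extended cluster onto an extended cluster (exchange to exchange variables) and commuting with mutations; $\mathrm{Aut}\,\mathcal A$ is their group, $\mathcal A^H=\{z:f(z)=z\ \forall f\in H\}$. Cluster subalgebras are $\mathcal A(\Sigma')\subseteq\mathcal A$ with $\Sigma'=\Sigma_{I_0,I_1}$ a mixing-type sub-seed (remove $I_1\subseteq\mathbf x_{ex}\cup\mathbf x_{fr}$, freeze $I_0\subseteq \mathbf x_{ex}$, $I_0\cap I_1=\emptyset$, restrict the matrix) of a seed of $\mathcal A$ with $b_{xy}=0$ for $x\in I_1$, $y\in\mathbf x_{ex}\setminus(I_0\cup I_1)$. Stable monomial basis: a $\mathbb Q$-basis $W$ of $\mathcal A$ consisting of monomials in cluster variables with $f(W)\subseteq W$ for all $f\in\mathrm{Aut}\,\mathcal A$. It has unique expression if whenever $x_{11}^{k_{11}}\cdots x_{1s_1}^{k_{1s_1}}=x_{21}^{k_{21}}\cdots x_{2s_2}^{k_{2s_2}}$ for two elements of $W$ (each written with distinct cluster variables and positive exponents), then $s_1=s_2$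 and there is a permutation $\sigma$ with $x_{1j}=x_{2\sigma(j)}$ for all $j$. $\mathcal D$-stable basis: choose a set $C_q\subseteq\mathcal A$ of elements each expressible as a Laurent polynomial with positive coefficients in some cluster, and a set $\mathcal D$ of subsets of $C_q\cup\mathcal X$ such that $U\cap\mathcal X$ is contained in a cluster for each $U\in\mathcal D$. For $z\in C_q\cup\mathcal X$, $k\in\mathbb Z_{>0}$, let $\langle k,z\rangle=z^k$ if $z\in\mathcal X$ and $\langle k,z\rangle=P_k(z)$ for a fixed $P_k\in R[z]$ otherwise. Suppose for all $f\in\mathrm{Aut}\,\mathcal A$: (a) $f(\langle k,z\rangle)=\langle k,f(z)\rangle$ for all $k$ and all $z$ in members of $\mathcal D$; (b) $f(U)\in\mathcal D$ for $U\in\mathcal D$; (c) $W=\bigcup_{U\in\mathcal D}\{\prod_{x\in U'}\langle k_x,x\rangle: U'\subseteq U, k_x\in\mathbb Z_{>0}\}$ is a $\mathbb Q$-basis of $\mathcal A$, and products over different sets $U_1\ne U_2$ are different. Then $W$ is a $\mathcal D$-stable basis, and elements of $C_q$ are called quasi cluster variables. *)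

(* Defs.v *)
From HB Require Import structures.
From mathcomp Require Import all_boot all_order all_algebra.
From mathcomp Require Import fraction fingroup perm.
From mathcomp Require Import mpoly.
From Stdlib Require Import ClassicalDescription.

Set Implicit Arguments.
Unset Strict Implicit.
Unset Printing Implicit Defensive.

Import Order.TTheory GRing.Theory Num.Theory.
Local Open Scope ring_scope.

Definition F (m : nat) : fieldType := {fraction {mpoly rat[m]}}.

(* A (generalised) seed: indices present [Vs], exchangeable indices [exs]
   (a subset of Vs), extended cluster [cl] (only entries in Vs are relevant),
   exchange matrix [bm] (only entries b_ij with i in Vs, j in exs matter). *)
Record seed (m : nat) := Seed {
  Vs  : {set 'I_m};
  exs : {set 'I_m};
  cl  : 'I_m -> F m;
  bm  : 'I_m -> 'I_m -> int }.

Section Cluster.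
Variable m : nat.
Local Notation F := (F m).
Local Notation seed := (seed m).

Definition mut_matrix (b : 'I_m -> 'I_m -> int) (k : 'I_m) : 'I_m -> 'I_m -> int :=
  fun i j => if (i == k) || (j == k) then - b i j
             else b i j + Num.sg (b i k) * Num.max (b i k * b k j) 0.

Definition mutate (S : seed) (k : 'I_m) : seed :=
  Seed (Vs S) (exs S)
    (fun i => if i == k then
       ((\prod_(j in Vs S | 0 < bm S j k) cl S j ^+ `|bm S j k|%N)
        + (\prod_(j in Vs S | bm S j k < 0) cl S j ^+ `|bm S j k|%N)) / cl S k
     else cl S i)
    (mut_matrix (bm S) k).

Inductive reach (S : seed) : seed -> Prop :=
| reach_refl : reach S S
| reach_step T k : reach S T -> k \in exs T -> reach S (mutate T k).

Definition ext_var (S : seed) (z : F) : Prop :=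
  exists T i, reach S T /\ i \in Vs S /\ z = cl T i.

Definition frozen_var (S : seed) (z : F) : Prop :=
  exists i, i \in Vs S /\ i \notin exs S /\ z = cl S i.

Inductive gen (G : F -> Prop) : F -> Prop :=
| gen_var x : G x -> gen G x
| gen_rat (q : rat) : gen G (ratr q)
| gen_add x y : gen G x -> gen G y -> gen G (x + y)
| gen_mul x y : gen G x -> gen G y -> gen G (x * y).

Definition CA (S : seed) : F -> Prop := gen (ext_var S).

Definition Rfr (S : seed) : F -> Prop := gen (frozen_var S).

Definition skew_symmetrizable (ex : {set 'I_m}) (b : 'I_m -> 'I_m -> int) : Prop :=
  exists d : 'I_m -> int, (forall i, 0 < d i) /\
    forall i j, i \in ex -> j \in ex -> d i * b i j = - (d j * b j i).

Definition Sigma (ex : {set 'I_m}) (b : 'I_m -> 'I_m -> int) : seed :=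
  Seed setT ex (fun i => FracField.tofrac (('X_i : {mpoly rat[m]}))) b.

Definition subseed (S : seed) (I0 I1 : {set 'I_m}) : seed :=
  Seed (Vs S :\: I1) (exs S :\: (I0 :|: I1)) (cl S) (bm S).

Definition cluster_subseed (S S' : seed) : Prop :=
  exists S0 (I0 I1 : {set 'I_m}), reach S S0 /\ [disjoint I0 & I1] /\ I0 \subset exs S /\
    I1 \subset Vs S /\
    (forall x y, x \in I1 -> y \in exs S :\: (I0 :|: I1) -> bm S0 x y = 0) /\
    S' = subseed S0 I0 I1.

(* Cluster automorphisms of A(S) (functions on F, relevant on A(S)). *)
Definition cluster_aut (S : seed) (f : F -> F) : Prop :=
  ((forall a, CA S a -> CA S (f a)) /\
   (forall a b, CA S a -> CA S b -> f a = f b -> a = b) /\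
   (forall b, CA S b -> exists2 a, CA S a & f a = b) /\
   (forall a b, CA S a -> CA S b -> f (a + b) = f a + f b) /\
   (forall a b, CA S a -> CA S b -> f (a * b) = f a * f b) /\
   (forall q a, CA S a -> f (ratr q * a) = ratr q * f a) /\
   f 1 = 1) /\
  exists T1 T2 (s : {perm 'I_m}),
      reach S T1 /\ reach S T2 /\
      (forall i, (s i \in exs S) = (i \in exs S)) /\
      (forall i, f (cl T1 i) = cl T2 (s i)) /\
      (forall k, k \in exs S -> f (cl (mutate T1 k) k) = cl (mutate T2 (s k)) (s k)).

Definition subgroup_aut (S : seed) (H : (F -> F) -> Prop) : Prop :=
  [/\ (forall f, H f -> cluster_aut S f),
      H id,
      (forall f g, H f -> H g -> H (f \o g)) &
      (forall f, H f -> (exists2 g, H g &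
          forall a, CA S a -> g (f a) = a /\ f (g a) = a))].

Definition invariants (S : seed) (H : (F -> F) -> Prop) (z : F) : Prop :=
  CA S z /\ forall f, H f -> f z = z.

Definition infinite_orbit (H : (F -> F) -> Prop) (z : F) : Prop :=
  forall s : seq F, exists f, H f /\ f z \notin s.

(* z is a Laurent polynomial with positive coefficients in the variables of
   some cluster of A(S) (coefficients in R = Q[frozen]: frozen exponents >= 0). *)
Definition pos_laurent (S : seed) (z : F) : Prop :=
  exists T, reach S T /\ exists s : seq (rat * {ffun 'I_m -> int}),
    (forall t, t \in s -> 0 < t.1) /\
    (forall t i, t \in s -> i \in Vs S -> i \notin exs S -> 0 <= t.2 i) /\
    z = \sum_(t <- s) ratr t.1 * \prod_(i in Vs S) cl T i ^ t.2 i.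

Definition Qbasis (A W : F -> Prop) : Prop :=
  [/\ (forall w, W w -> A w),
      (forall (s : seq F) (c : F -> rat), uniq s -> (forall w, w \in s -> W w) ->
         \sum_(w <- s) ratr (c w) * w = 0 -> forall w, w \in s -> c w = 0) &
      (forall a, A a -> exists s : seq F, exists c : F -> rat,
         uniq s /\ (forall w, w \in s -> W w) /\ a = \sum_(w <- s) ratr (c w) * w)].

Definition monomial_expr (S : seed) (w : F) (s : seq F) (k : F -> nat) : Prop :=
  [/\ uniq s, (forall x, x \in s -> ext_var S x /\ (0 < k x)%N) &
      w = \prod_(x <- s) x ^+ k x].

Definition stable_monomial_basis_unique (S : seed) (W : F -> Prop) : Prop :=
  [/\ Qbasis (CA S) W,
      (forall w, W w -> exists s k, monomial_expr S w s k),
      (forall f w, cluster_aut S f -> W w -> W (f w)) &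
      (forall w s1 k1 s2 k2, W w -> monomial_expr S w s1 k1 ->
         monomial_expr S w s2 k2 -> perm_eq s1 s2)].

Definition bracket (S : seed) (P : nat -> {poly F}) (k : nat) (z : F) : F :=
  if excluded_middle_informative (ext_var S z) then z ^+ k else (P k).[z].

Definition Dprod (S : seed) (P : nat -> {poly F}) (U : F -> Prop)
    (s : seq F) (k : F -> nat) (w : F) : Prop :=
  [/\ uniq s, (forall x, x \in s -> U x /\ (0 < k x)%N) &
      w = \prod_(x <- s) bracket S P (k x) x].

Definition Dstable_basis (S : seed) (Cq : F -> Prop)
    (D : (F -> Prop) -> Prop) (P : nat -> {poly F}) : Prop :=
  (forall z, Cq z -> CA S z /\ pos_laurent S z) /\
  (forall k j, Rfr S (P k)`_j) /\
  (forall U, D U -> forall z, U z -> Cq z \/ ext_var S z) /\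
  (forall U, D U -> exists T, reach S T /\
      forall z, U z -> ext_var S z -> exists2 i, i \in Vs S & z = cl T i) /\
  (forall f U z k, cluster_aut S f -> D U -> U z -> (0 < k)%N ->
      f (bracket S P k z) = bracket S P k (f z)) /\
  (forall f U, cluster_aut S f -> D U ->
      exists2 U2, D U2 & forall y, U2 y <-> exists2 x, U x & y = f x) /\
  Qbasis (CA S) (fun w => exists U s k, D U /\ Dprod S P U s k w) /\
  (forall U1 U2 s1 s2 k1 k2 w, D U1 -> D U2 -> Dprod S P U1 s1 k1 w ->
      Dprod S P U2 s2 k2 w -> perm_eq s1 s2).

End Cluster.

(* Main.v *)
Require Import Defs.
From HB Require Import structures.
From mathcomp Require Import all_boot all_order all_algebra.
From mathcomp Require Import fingroup perm generic_quotient fraction mpoly.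
From mathcomp Require Import zify ring.
From Stdlib Require Import ClassicalDescription Classical_Prop FunctionalExtensionality.

(** (i) If the orbit of [z] is finite, its orbit polynomial [g] has coefficients
    in the invariants, hence in the field [L] generated by the variables of the
    seed of which [S1] is a sub-seed that are not deleted in [S1]. Specializing
    the deleted variables to generic rational numbers fixes [L] and sends the
    root [z] of [g] to another root [w] of [g], which lies in [L]. As [H] fixes
    [L], the orbit of [w] is trivial; but [w] belongs to the orbit of [z], so
    [z] is invariant.

    (ii) Elements of [H] permute the basis, so the support of an invariant [z]
    is stable under [H] and its members have finite orbits. By uniqueness of the
    expression the factors of these members have finite orbits too, so they lie
    in [CA S1]. Frozen variables are permuted by [H], so they also lie in [CA S1].
    That cluster automorphisms preserve cluster variables follows from
    comparing exchange polynomials: a single step of compatibility with mutation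
    forces the exchange matrices to agree column by column up to sign, and this
    property is preserved by mutation. *)

Set Implicit Arguments.
Unset Strict Implicit.
Unset Printing Implicit Defensive.

Local Open Scope quotient_scope.
Import Order.TTheory GRing.Theory Num.Theory.
Local Open Scope ring_scope.

(** * Induction on polynomials and representation of fractions *)

Lemma mpoly_ring_ind (n : nat) (R : comNzRingType) (Pr : {mpoly R[n]} -> Prop) :
  (forall c, Pr c%:MP) -> (forall i, Pr 'X_i) ->
  (forall p q, Pr p -> Pr q -> Pr (p + q)) ->
  (forall p q, Pr p -> Pr q -> Pr (p * q)) -> forall p, Pr p.
Proof.
move=> hC hX hD hM; elim/mpolyind => [|c mm p _ _ hp]; first by rewrite -mpolyC0.
apply: (hD) hp; rewrite -mul_mpolyC; apply: (hM) => //.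
rewrite mpolyXE_id; apply: (big_ind Pr) => // [|i _]; first by rewrite -mpolyC1.
by elim: (mm i) => [|d ih]; rewrite ?expr0 -?mpolyC1 // exprS; apply: hM.
Qed.

Lemma fractionP (R : idomainType) (z : {fraction R}) :
  exists P Q, Q != 0 /\ z = FracField.tofrac P / FracField.tofrac Q.
Proof.
pose x := repr z; exists (\n_x), (\d_x); split; first exact: denom_ratioP.
have nd : FracField.tofrac \d_x != 0 :> {fraction R} by rewrite tofrac_eq0 denom_ratioP.
apply: (mulIf nd); rewrite divfK // -[z]reprK -/x.
rewrite -[LHS]/(FracField.mul _ _) !piE /FracField.mulf.
apply/eqmodP; rewrite /= FracField.equivfE.
by rewrite !numden_Ratio ?mulf_neq0 ?oner_eq0 ?denom_ratioP // !mulr1 mulrC.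
Qed.

(** * Free generators of a field and exchange binomials *)

Section Evaluation.
Variables (m : nat) (K : fieldType) (iota : {rmorphism rat -> K}).
Local Notation MP := {mpoly rat[m]}.
Implicit Types (c : 'I_m -> K) (P Q : MP).

Definition ev c : MP -> K := mmap iota c.

HB.instance Definition _ c := GRing.RMorphism.copy (ev c) (mmap iota c).

Lemma evC c q : ev c q%:MP = ratr q.
Proof. by rewrite /ev mmapC; apply: fmorph_eq_rat. Qed.

Lemma evX c i : ev c 'X_i = c i.
Proof. by rewrite /ev mmapX mmap1U. Qed.

Lemma evXm c mm : ev c 'X_[mm] = \prod_i c i ^+ mm i.
Proof. by rewrite /ev mmapX. Qed.

Lemma ratr0 : ratr 0 = 0 :> K. Proof. exact: (ratr_int _ 0). Qed.
Lemma ratr1 : ratr 1 = 1 :> K. Proof. exact: (ratr_int _ 1). Qed.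

(** With [xpredT] this is the whole field generated by [c]; a smaller [Pr] containing the constants
    and closed under sums and products gives a subfield. *)
Definition frac_of c (Pr : MP -> Prop) (z : K) : Prop :=
  exists P Q, [/\ Pr P, Pr Q, ev c Q != 0 & z = ev c P / ev c Q].

Section FracOf.
Variables (c : 'I_m -> K) (Pr : MP -> Prop).
Hypotheses (prC : forall q, Pr q%:MP)
  (prD : forall P Q, Pr P -> Pr Q -> Pr (P + Q))
  (prM : forall P Q, Pr P -> Pr Q -> Pr (P * Q)).

Lemma frac_of_ev P : Pr P -> frac_of c Pr (ev c P).
Proof.
by move=> hP; exists P, 1%:MP; split; rewrite // ?evC ?ratr1 ?oner_eq0 ?divr1.
Qed.

Lemma frac_of_ratr q : frac_of c Pr (ratr q).
Proof. by rewrite -(evC c); apply: frac_of_ev. Qed.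

Lemma frac_of_add x y : frac_of c Pr x -> frac_of c Pr y -> frac_of c Pr (x + y).
Proof.
move=> [P [Q [hP hQ nQ ->]]] [P' [Q' [hP' hQ' nQ' ->]]].
exists (P * Q' + P' * Q), (Q * Q'); split; auto.
  by rewrite rmorphM mulf_neq0.
by rewrite rmorphD !rmorphM addf_div.
Qed.

Lemma frac_of_mul x y : frac_of c Pr x -> frac_of c Pr y -> frac_of c Pr (x * y).
Proof.
move=> [P [Q [hP hQ nQ ->]]] [P' [Q' [hP' hQ' nQ' ->]]].
exists (P * P'), (Q * Q'); split; auto.
  by rewrite rmorphM mulf_neq0.
by rewrite !rmorphM mulf_div.
Qed.

Lemma frac_of_inv x : frac_of c Pr x -> frac_of c Pr x^-1.
Proof.
move=> [P [Q [hP hQ nQ ->]]].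
have [P0|nP] := eqVneq (ev c P) 0.
  by rewrite P0 mul0r invr0 -ratr0; apply: frac_of_ratr.
by exists Q, P; split; rewrite // invfM invrK mulrC.
Qed.

End FracOf.

(** Algebraic independence over the rationals together with generation of [K] as a field: what an
    extended cluster satisfies in the ambient field. *)
Record free_gens c : Prop := FreeGens {
  ev_inj0 : forall P, ev c P = 0 -> P = 0;
  ev_frac : forall z, frac_of c xpredT z }.

Lemma ev_neq0 c : free_gens c -> forall P, P != 0 -> ev c P != 0.
Proof. by move=> hc P; apply: contraNneq => /(ev_inj0 hc) ->. Qed.

Lemma free_gens_neq0 c i : free_gens c -> c i != 0.
Proof. move=> hc; rewrite -(evX c) ev_neq0 //; apply/eqP => /(congr1 (meval (fun=> 1))).
by rewrite mevalXU meval0 => /eqP; rewrite oner_eq0. Qed.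

Lemma ev_inj c : free_gens c -> injective (ev c).
Proof. by move=> hc P Q e; apply/subr0_eq/(ev_inj0 hc); rewrite rmorphB /= e subrr. Qed.

Lemma ev_gen (A : K -> Prop) c P : (forall q, A (ratr q)) ->
  (forall x y, A x -> A y -> A (x + y)) -> (forall x y, A x -> A y -> A (x * y)) ->
  (forall i, A (c i)) -> A (ev c P).
Proof.
move=> hC hD hM hX; elim/mpoly_ring_ind: P => [q|i|p q ihp ihq|p q ihp ihq].
- by rewrite evC.
- by rewrite evX.
- by rewrite rmorphD; apply: hD.
- by rewrite rmorphM; apply: hM.
Qed.

(* [M] does not involve ['X_k], so the substitution exchanging [c k] and [c' k]
   is an involution up to powers of these two elements; hence injectivity. *)
Lemma free_gens_exchange c c' k M : free_gens c ->
  (forall i, i != k -> c' i = c i) ->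
  c k * c' k = ev c M -> ev c' M = ev c M -> M != 0 -> free_gens c'.
Proof.
move=> hc hc' hk hM nM.
have nk := free_gens_neq0 k hc.
have nk' : c' k != 0.
  by apply: contraNneq (ev_neq0 hc nM) => e; rewrite -hk e mulr0.
split=> [P hP|z].
  have [N [P' [h1 h2]]] : exists N P',
      ev c' P * c k ^+ N = ev c P' /\ ev c' P' = ev c P * c' k ^+ N.
    elim/mpoly_ring_ind: {hP}P => [q|i|p q [N1 [p' [a1 a2]]] [N2 [q' [b1 b2]]]
                                     |p q [N1 [p' [a1 a2]]] [N2 [q' [b1 b2]]]].
    - by exists 0%N, q%:MP; rewrite !expr0 !mulr1 !evC.
    - have [->|ni] := eqVneq i k.
        by exists 1%N, M; rewrite !expr1 !evX hM -hk mulrC.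
      by exists 0%N, 'X_i; rewrite !expr0 !mulr1 !evX hc'.
    - exists (N1 + N2)%N, (p' * 'X_k ^+ N2 + q' * 'X_k ^+ N1).
      rewrite !rmorphD !rmorphM !rmorphXn /= !evX -a1 a2 -b1 b2 !exprD.
      by split; ring.
    - exists (N1 + N2)%N, (p' * q').
      rewrite !rmorphM /= -a1 a2 -b1 b2 !exprD.
      by split; ring.
  move/esym: h1; rewrite hP mul0r => /(ev_inj0 hc) P'0.
  move/esym/eqP: h2; rewrite P'0 rmorph0 mulf_eq0 expf_eq0 (negPf nk') andbF orbF.
  by move/eqP/(ev_inj0 hc).
have hT : forall i, frac_of c' xpredT (c i).
  move=> i; have [->|ni] := eqVneq i k; last first.
    by rewrite -hc' // -(evX c'); apply: frac_of_ev.
  rewrite (canRL (mulfK nk') hk) -hM; apply: frac_of_mul => //; first exact: frac_of_ev.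
  by apply: frac_of_inv => //; rewrite -(evX c'); apply: frac_of_ev.
have hE P : frac_of c' xpredT (ev c P).
  by apply: ev_gen => //; [apply: frac_of_ratr|apply: frac_of_add|apply: frac_of_mul].
have [P [Q [_ _ nQ ->]]] := ev_frac hc z.
by apply: frac_of_mul => //; apply: frac_of_inv.
Qed.

(** The right-hand side of the exchange relation for a matrix column [v], kept as a formal
    polynomial so that exponents can be read off; [exch] is its value at [c]. *)
Definition exch_poly (v : 'I_m -> int) : MP :=
  'X_[[multinom (if (0 < v j)%R then `|v j|%N else 0%N) | j < m]]
  + 'X_[[multinom (if (v j < 0)%R then `|v j|%N else 0%N) | j < m]].

Definition exch c (v : 'I_m -> int) : K :=
  \prod_(j | 0 < v j) c j ^+ `|v j|%N + \prod_(j | v j < 0) c j ^+ `|v j|%N.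

Lemma ev_exch_poly c v : ev c (exch_poly v) = exch c v.
Proof.
rewrite rmorphD /= !evXm /exch !(big_mkcond (fun j => _ < _)) /=.
by congr (_ + _); apply: eq_bigr => j _; rewrite mnmE; case: ifP.
Qed.

Lemma exch_poly_neq0 v : exch_poly v != 0.
Proof.
apply/eqP => /(congr1 (meval (fun=> 1))); rewrite mevalD !mevalX meval0.
by rewrite !big1 // => i _; rewrite expr1n.
Qed.

(** The coefficient of ['X_[A]] on the left is 1 or 2, hence nonzero over the rationals, so [A] is
    [C] or [D]; cancelling it leaves two equal monomials. *)
Lemma mpolyX_add_inj (A B C D : 'X_{1..m}) :
  'X_[A] + 'X_[B] = 'X_[C] + 'X_[D] :> MP -> (A = C /\ B = D) \/ (A = D /\ B = C).
Proof.
move=> e; have Xinj (a b : 'X_{1..m}) : 'X_[a] = 'X_[b] :> MP -> a = b.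
  move/(congr1 (mcoeff a)); rewrite !mcoeffX eqxx eq_sym.
  by case: eqP => // _ /eqP; rewrite oner_eq0.
have := congr1 (mcoeff A) e; rewrite !mcoeffD !mcoeffX eqxx.
have [eC _|_] := eqVneq C A.
  by left; split=> //; apply: Xinj; move: e; rewrite eC => /addrI.
have [eD _|_] := eqVneq D A.
  by right; split=> //; apply: Xinj; move: e; rewrite eD [RHS]addrC => /addrI.
by case: (B == A).
Qed.

(** Algebraic independence turns equal values into equal binomials. The two exponents are the
    positive and negative parts of the column, and the only ambiguity, swapping the monomials,
    changes the sign of the whole column. *)
Lemma exch_inj c u v : free_gens c -> exch c u = exch c v ->
  (forall j, u j = v j) \/ (forall j, u j = - v j).
Proof.
rewrite -!ev_exch_poly => hc /(ev_inj hc) /mpolyX_add_inj.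
case=> -[/mnmP h1 /mnmP h2]; [left|right] => j; have := h1 j; have := h2 j;
  rewrite !mnmE; do 4?case: ifP; lia.
Qed.
End Evaluation.

Definition ratF (m : nat) : {rmorphism rat -> F m} :=
  (@FracField.tofrac {mpoly rat[m]} \o @mpolyC m rat).

Section RatF.
Variable m : nat.
Lemma ev_tofrac P :
  ev (ratF m) (fun i => FracField.tofrac 'X_i) P = FracField.tofrac P :> F m.
Proof.
elim/mpoly_ring_ind: P => [q|i|p q ihp ihq|p q ihp ihq].
- by rewrite /ev mmapC.
- by rewrite evX.
- by rewrite !rmorphD /= ihp ihq.
- by rewrite !rmorphM /= ihp ihq.
Qed.

Lemma free_gens_initial : free_gens (ratF m) (fun i => FracField.tofrac 'X_i).
Proof.
split=> [P|z]; first by move/eqP; rewrite ev_tofrac tofrac_eq0 => /eqP.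
by have [P [Q [nQ ->]]] := fractionP z; exists P, Q; rewrite !ev_tofrac tofrac_eq0.
Qed.

End RatF.

Lemma eq_exch (m : nat) (K : fieldType) (c c' : 'I_m -> K) v :
  (forall j, v j != 0 -> c' j = c j) -> exch c' v = exch c v.
Proof.
move=> h; rewrite /exch; congr (_ + _); apply: eq_bigr => j vj; rewrite h //.
  by rewrite gt_eqF.
by rewrite lt_eqF.
Qed.

Lemma exch_perm (m : nat) (K : fieldType) (c : 'I_m -> K) (s : {perm 'I_m}) v :
  exch (fun i => c (s i)) (fun i => v (s i)) = exch c v.
Proof.
by rewrite /exch; congr (_ + _); rewrite [RHS](reindex_inj (@perm_inj _ s)).
Qed.

Lemma exch_opp (m : nat) (K : fieldType) (c : 'I_m -> K) v :
  exch c (fun i => - v i) = exch c v.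
Proof.
rewrite /exch addrC; congr (_ + _); apply: eq_big => j;
  by rewrite ?oppr_gt0 ?oppr_lt0 ?abszN.
Qed.

(** * Labelled seeds, mutation and its reversibility *)

Section Seeds.
Variables (m : nat) (ex : {set 'I_m}).
Local Notation K := (F m).
Implicit Types (S T : seed m) (k : 'I_m).

(** The properties of a seed that mutation preserves. All indices are present here, in contrast to
    sub-seeds, where deleted indices leave [Vs]. *)
Record labeled_seed T : Prop := LabeledSeed {
  lseed_Vs : Vs T = setT;
  lseed_exs : exs T = ex;
  lseed_skew : skew_symmetrizable ex (bm T);
  lseed_free : free_gens (ratF m) (cl T) }.

Lemma skew_diag (b : 'I_m -> 'I_m -> int) k :
  skew_symmetrizable ex b -> k \in ex -> b k k = 0.
Proof. by case=> d [d_gt0 h] hk; have := h _ _ hk hk; have := d_gt0 k; nia. Qed.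

Lemma cl_mutate T k i : Vs T = setT ->
  cl (mutate T k) i =
  if i == k then exch (cl T) (fun j => bm T j k) / cl T k else cl T i.
Proof.
move=> hV; rewrite /mutate /= hV /exch; case: ifP => // _.
by congr ((_ + _) / _); apply: eq_bigl => j; rewrite inE.
Qed.

Lemma skew_mutate b k : k \in ex -> skew_symmetrizable ex b ->
  skew_symmetrizable ex (mut_matrix b k).
Proof.
move=> hk [d [d_gt0 h]]; exists d; split=> // i j hi hj.
rewrite /mut_matrix [(j == k) || _]orbC; case: ifP => _.
  by rewrite !mulrN (h _ _ hi hj).
have hij := h _ _ hi hj; have hik := h _ _ hi hk; have hjk := h _ _ hj hk.
have di := d_gt0 i; have dj := d_gt0 j; have dk := d_gt0 k.
(* Once multiplied by [d k], both sides equal [- (d k * b k i) * (d k * b k j)]. *)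
have e : d i * (b i k * b k j) = d j * (b j k * b k i).
  apply: (mulIf (lt0r_neq0 dk)).
  transitivity ((d i * b i k) * (d k * b k j)); first by ring.
  transitivity ((d j * b j k) * (d k * b k i)); last by ring.
  by rewrite hik hjk; ring.
have [pos|npos] := ltP 0 (b i k * b k j); last first.
  have npos' : b j k * b k i <= 0 by nia.
  by rewrite !max_r // !mulr0 !addr0.
have pos' : 0 < b j k * b k i by nia.
rewrite !max_l ?ltW // !mulrDr hij opprD; congr (_ + _).
rewrite [LHS]mulrCA e [in RHS]mulrCA -mulNr; congr (_ * _).
(* A positive product gives [b i k] and [b k j] the same sign, while [b k j] and [b j k] have
   opposite signs; so the two sign factors differ by -1, as skew-symmetry requires. *)
have [[si sj]|[si sj]] : (0 < b i k /\ b j k < 0) \/ (b i k < 0 /\ 0 < b j k).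
- by clear -pos hjk dj dk; case: (ltrgtP (b k j) 0) => [lt|gt|e]; [right|left|]; nia.
- by rewrite gtr0_sg // ltr0_sg // opprK.
- by rewrite ltr0_sg // gtr0_sg.
Qed.

(** The old and new variables at [k] multiply to the exchange binomial, which does not involve [k]
    since the diagonal entry vanishes; hence freeness survives the exchange. *)
Lemma labeled_seed_mutate T k : k \in ex -> labeled_seed T -> labeled_seed (mutate T k).
Proof.
move=> hk [hV hE hS hF]; split=> //; first exact: skew_mutate.
have b0 := skew_diag hS hk.
pose v := fun j => bm T j k.
have off i : i != k -> cl (mutate T k) i = cl T i.
  by move=> ni; rewrite cl_mutate // (negPf ni).
apply: (@free_gens_exchange _ _ _ (cl T) _ k (exch_poly v)) => //.
- rewrite cl_mutate // eqxx ev_exch_poly mulrC divfK //.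
  exact: free_gens_neq0 hF.
- rewrite !ev_exch_poly; apply: eq_exch => j nj; apply: off.
  by apply: contraNneq nj => ->; rewrite /v b0.
- exact: exch_poly_neq0.
Qed.

Lemma cl_neq0 T i : labeled_seed T -> cl T i != 0.
Proof. by move/lseed_free/free_gens_neq0. Qed.

(** The second mutation sees column [k] negated, which only swaps the two monomials of the binomial,
    and in the matrix the two correction terms cancel. The equality is one of records, whence
    functional extensionality. *)
Lemma mutateK T k : k \in ex -> labeled_seed T -> mutate (mutate T k) k = T.
Proof.
move=> hk hT; have hT' := labeled_seed_mutate hk hT.
have b0 := skew_diag (lseed_skew hT) hk.
case E : (mutate (mutate T k) k) => [V X c B].
have -> : V = Vs T by rewrite -[LHS]/(Vs (Seed V X c B)) -E.
have -> : X = exs T by rewrite -[LHS]/(exs (Seed V X c B)) -E.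
have -> : c = cl T.
  rewrite -[LHS]/(cl (Seed V X c B)) -E; apply: functional_extensionality => i.
  rewrite cl_mutate ?(lseed_Vs hT') // cl_mutate ?(lseed_Vs hT) //.
  have [->|ni] := eqVneq i k; last by rewrite cl_mutate ?(lseed_Vs hT) // (negPf ni).
  have -> : exch (cl (mutate T k)) (fun j => bm (mutate T k) j k)
          = exch (cl T) (fun j => bm T j k).
    rewrite -[RHS]exch_opp (_ : (fun j => bm (mutate T k) j k) = fun j => - bm T j k).
      apply: eq_exch => j nj; rewrite cl_mutate ?(lseed_Vs hT) //.
      by have [ej|//] := eqVneq j k; rewrite ej b0 oppr0 eqxx in nj.
    by apply: functional_extensionality => j; rewrite /= /mut_matrix eqxx orbT.
  have n1 := cl_neq0 k hT; have := cl_neq0 k hT'.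
  rewrite cl_mutate ?(lseed_Vs hT) // eqxx mulf_eq0 negb_or => /andP[n2 _].
  by rewrite invfM invrK mulVKf.
have -> : B = bm T; last by case: (T).
rewrite -[LHS]/(bm (Seed V X c B)) -E.
apply: functional_extensionality => i; apply: functional_extensionality => j.
rewrite /= /mut_matrix !eqxx !orbT /=.
by case: (_ || _); rewrite ?opprK // mulrNN sgrN mulNr addrK.
Qed.

Lemma reach_labeled S T : labeled_seed S -> reach S T -> labeled_seed T.
Proof.
move=> hS; elim=> // T' k _ hT' hk; apply: labeled_seed_mutate => //.
by rewrite -(lseed_exs hT').
Qed.

Lemma reach_trans S T U : reach S T -> reach T U -> reach S U.
Proof. by move=> hST; elim=> // U' k _ h hk; apply: reach_step. Qed.

Lemma reach_sym S T : labeled_seed S -> reach S T -> reach T S.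
Proof.
move=> hS; elim=> [|T' k hST' h hk]; first exact: reach_refl.
have hT' := reach_labeled hS hST'.
have hk' : k \in ex by rewrite -(lseed_exs hT').
apply: reach_trans h; rewrite -{2}(mutateK hk' hT').
by apply: reach_step => //; apply: reach_refl.
Qed.

Lemma frozen_cl S T i : reach S T -> i \notin exs S -> cl T i = cl S i.
Proof.
move=> h hi; have: cl T i = cl S i /\ exs T = exs S; last by case.
elim: h => // T' k _ [e1 e2] hk; split=> //=.
by case: eqP => // eik; rewrite eik -e2 hk in hi.
Qed.
End Seeds.

Lemma labeled_seed_Sigma (m : nat) (ex : {set 'I_m}) b :
  skew_symmetrizable ex b -> labeled_seed ex (Sigma ex b).
Proof. by move=> h; split=> //; apply: free_gens_initial. Qed.

(** * Algebra automorphisms and their action on polynomials *)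

Lemma coef_XsubC (R : nzRingType) (x : R) i :
  ('X - x%:P)`_i = if i == 0%N then - x else (i == 1%N)%:R.
Proof.
rewrite coefB coefX coefC.
by case: i => [|[|i]]; rewrite /= ?mulr0n ?subr0 ?sub0r.
Qed.

Lemma map_poly_XsubC (R : nzRingType) (f : R -> R) x :
  f 0 = 0 -> f 1 = 1 -> f (- x) = - f x -> map_poly f ('X - x%:P) = 'X - (f x)%:P.
Proof.
move=> f0 f1 fN; apply/polyP=> i; rewrite coef_map_id0 // !coef_XsubC.
by case: i => [|[|i]].
Qed.

Record subalg (K : fieldType) (A : K -> Prop) : Prop := Subalg {
  sub_rat : forall q, A (ratr q);
  sub_add : forall x y, A x -> A y -> A (x + y);
  sub_mul : forall x y, A x -> A y -> A (x * y) }.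

(** [f] is a function on the whole field of which essentially only the behaviour on [A] is
    controlled; computations with it therefore remain inside [A]. *)
Record alg_aut (K : fieldType) (A : K -> Prop) (f : K -> K) : Prop := AlgAut {
  aut_closed : forall a, A a -> A (f a);
  aut_inj : forall a b, A a -> A b -> f a = f b -> a = b;
  aut_add : forall a b, A a -> A b -> f (a + b) = f a + f b;
  aut_mul : forall a b, A a -> A b -> f (a * b) = f a * f b;
  aut_scale : forall q a, A a -> f (ratr q * a) = ratr q * f a;
  aut_one : f 1 = 1 }.

Section AlgAut.
Variables (K : fieldType) (A : K -> Prop).
Hypothesis hA : subalg A.

Lemma sub0 : A 0. Proof. by rewrite -ratr0; apply: (sub_rat hA). Qed.
Lemma sub1 : A 1. Proof. by rewrite -ratr1; apply: (sub_rat hA). Qed.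

Lemma sub_opp x : A x -> A (- x).
Proof.
move=> hx; rewrite -mulN1r; apply: (sub_mul hA) => //.
by rewrite -[-1](ratr_int K (-1)); apply: (sub_rat hA).
Qed.

Lemma sub_sum (I : eqType) (r : seq I) (P : pred I) (g : I -> K) :
  (forall i, i \in r -> P i -> A (g i)) -> A (\sum_(i <- r | P i) g i).
Proof.
move=> h; rewrite big_seq_cond; apply: (big_ind A); first exact: sub0.
  exact: (sub_add hA).
by move=> i /andP[]; apply: h.
Qed.

Lemma sub_prod (I : eqType) (r : seq I) (P : pred I) (g : I -> K) :
  (forall i, i \in r -> P i -> A (g i)) -> A (\prod_(i <- r | P i) g i).
Proof.
move=> h; rewrite big_seq_cond; apply: (big_ind A); first exact: sub1.
  exact: (sub_mul hA).
by move=> i /andP[]; apply: h.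
Qed.

Lemma sub_exp x n : A x -> A (x ^+ n).
Proof.
move=> hx; elim: n => [|n ih]; first by rewrite expr0; apply: sub1.
by rewrite exprS; apply: (sub_mul hA).
Qed.

Lemma sub_horner (p : {poly K}) x : (forall i, A p`_i) -> A x -> A p.[x].
Proof.
move=> hp hx; rewrite horner_coef; apply: sub_sum => i _ _.
by apply: (sub_mul hA) => //; apply: sub_exp.
Qed.


Variable f : K -> K.
Hypothesis hf : alg_aut A f.

Lemma aut0 : f 0 = 0.
Proof.
by rewrite -[X in f X](mul0r 1) -ratr0 (aut_scale hf) ?ratr0 ?mul0r //; apply: sub1.
Qed.

Lemma aut_sum (I : eqType) (r : seq I) (P : pred I) (g : I -> K) :
  (forall i, i \in r -> P i -> A (g i)) ->
  f (\sum_(i <- r | P i) g i) = \sum_(i <- r | P i) f (g i).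
Proof.
elim: r => [|i r ih] h; first by rewrite !big_nil aut0.
have h' : forall j, j \in r -> P j -> A (g j).
  by move=> j jr; apply: h; rewrite inE jr orbT.
rewrite !big_cons; case: ifP => Pi; last exact: ih.
rewrite (aut_add hf) ?ih //; first by apply: h; rewrite ?mem_head.
exact: sub_sum.
Qed.

Lemma aut_prod (I : eqType) (r : seq I) (P : pred I) (g : I -> K) :
  (forall i, i \in r -> P i -> A (g i)) ->
  f (\prod_(i <- r | P i) g i) = \prod_(i <- r | P i) f (g i).
Proof.
elim: r => [|i r ih] h; first by rewrite !big_nil (aut_one hf).
have h' : forall j, j \in r -> P j -> A (g j).
  by move=> j jr; apply: h; rewrite inE jr orbT.
rewrite !big_cons; case: ifP => Pi; last exact: ih.
rewrite (aut_mul hf) ?ih //; first by apply: h; rewrite ?mem_head.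
exact: sub_prod.
Qed.

Lemma aut_exp x n : A x -> f (x ^+ n) = f x ^+ n.
Proof.
move=> hx; elim: n => [|n ih]; first by rewrite !expr0 (aut_one hf).
by rewrite !exprS (aut_mul hf) ?ih //; apply: sub_exp.
Qed.

Lemma aut_exch (m : nat) (c : 'I_m -> K) v : (forall j, A (c j)) ->
  f (exch c v) = exch (fun j => f (c j)) v.
Proof.
move=> hc; rewrite /exch (aut_add hf); try by apply: sub_prod => *; apply: sub_exp.
rewrite !aut_prod; try by move=> *; apply: sub_exp.
by congr (_ + _); apply: eq_bigr => j _; rewrite aut_exp.
Qed.

Lemma aut_map_polyM (p q : {poly K}) :
  (forall i, A p`_i) -> (forall i, A q`_i) ->
  map_poly f (p * q) = map_poly f p * map_poly f q.
Proof.
move=> hp hq; apply/polyP => i; rewrite coef_map_id0 ?aut0 // !coefM.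
rewrite aut_sum => [|j _ _]; last exact: (sub_mul hA).
by apply: eq_bigr => j _; rewrite (aut_mul hf) // !coef_map_id0 ?aut0.
Qed.

Lemma coef_prod_XsubC_gen (s : seq K) : (forall x, x \in s -> A x) ->
  forall i, A (\prod_(x <- s) ('X - x%:P))`_i.
Proof.
elim: s => [|x s ih] h i.
  by rewrite big_nil coef1; case: eqP => _; [exact: sub1|exact: sub0].
have hs : forall y, y \in s -> A y by move=> y ys; apply: h; rewrite inE ys orbT.
rewrite big_cons mulrBl coefB coefXM coefCM; apply: (sub_add hA).
  by case: ifP => _; [exact: sub0|exact: ih].
by apply: sub_opp; apply: (sub_mul hA); [apply: h; rewrite mem_head|exact: ih].
Qed.

Lemma aut_opp x : A x -> f (- x) = - f x.
Proof.
move=> hx; apply/eqP; rewrite -subr_eq0 opprK; apply/eqP.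
by rewrite -(aut_add hf) ?addNr ?aut0 //; apply: sub_opp.
Qed.

Lemma coef_XsubC_gen x i : A x -> A ('X - x%:P)`_i.
Proof.
move=> hx; rewrite coef_XsubC; case: i => [|[|i]]; first exact: sub_opp.
  exact: sub1.
exact: sub0.
Qed.

Lemma aut_map_XsubC x : A x -> map_poly f ('X - x%:P) = 'X - (f x)%:P.
Proof.
by move=> hx; apply: map_poly_XsubC; [exact: aut0|exact: aut_one hf|exact: aut_opp].
Qed.

(** When [f] permutes [s], this makes every coefficient of the product fixed by [f]. *)
Lemma aut_prod_XsubC (s : seq K) : (forall x, x \in s -> A x) ->
  map_poly f (\prod_(x <- s) ('X - x%:P)) = \prod_(x <- map f s) ('X - x%:P).
Proof.
elim: s => [|x s ih] h.
  rewrite !big_nil; apply/polyP=> i; rewrite (coef_map_id0 _ _ aut0) coef1.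
  by case: eqP => _; [exact: aut_one hf|exact: aut0].
have hs : forall y, y \in s -> A y by move=> y ys; apply: h; rewrite inE ys orbT.
have hx : A x by apply: h; rewrite mem_head.
rewrite /= !big_cons -aut_map_XsubC // -ih //; apply: aut_map_polyM => i.
  exact: coef_XsubC_gen.
exact: coef_prod_XsubC_gen.
Qed.
End AlgAut.

(** * Cluster automorphisms preserve cluster variables and frozen variables *)

Lemma subalg_gen (m : nat) (G : F m -> Prop) : subalg (gen G).
Proof. by split; [exact: gen_rat|exact: gen_add|exact: gen_mul]. Qed.

Lemma gen_incl (m : nat) (G : F m -> Prop) (A : F m -> Prop) :
  (forall q, A (ratr q)) -> (forall x y, A x -> A y -> A (x + y)) ->
  (forall x y, A x -> A y -> A (x * y)) -> (forall x, G x -> A x) ->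
  forall x, gen G x -> A x.
Proof. by move=> hq hD hM hG x; elim=> {x} [x /hG|q|x y|x y] *; auto. Qed.

Lemma cluster_aut_alg (m : nat) (S : seed m) f :
  cluster_aut S f -> alg_aut (CA S) f.
Proof. by case=> [[? [? [_ [? [? [? ?]]]]]] _]. Qed.

Section ClusterAut.
Variables (m : nat) (ex : {set 'I_m}) (S : seed m).
Hypothesis hS : labeled_seed ex S.

Lemma cl_CA T i : reach S T -> CA S (cl T i).
Proof. by move=> hT; apply: gen_var; exists T, i; rewrite (lseed_Vs hS) inE. Qed.

Lemma mutate_mul T k : labeled_seed ex T ->
  cl (mutate T k) k * cl T k = exch (cl T) (fun j => bm T j k).
Proof.
move=> hT; rewrite cl_mutate ?(lseed_Vs hT) // eqxx divfK //.
exact: cl_neq0 hT.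
Qed.

Record similar (f : F m -> F m) (s : {perm 'I_m}) T T' : Prop := Similar {
  sim_l : reach S T;
  sim_r : reach S T';
  sim_cl : forall i, f (cl T i) = cl T' (s i);
  sim_bm : forall j, j \in ex -> (forall i, bm T' (s i) (s j) = bm T i j) \/
                                 (forall i, bm T' (s i) (s j) = - bm T i j) }.

(** Applying [f] to the exchange relation of [T] at [k] gives two exchange binomials in the free
    cluster of [T'] with equal values; [exch_inj] then compares the columns. *)
Lemma similar_of_exch f (s : {perm 'I_m}) T T' : alg_aut (CA S) f ->
  (forall i, (s i \in ex) = (i \in ex)) -> reach S T -> reach S T' ->
  (forall i, f (cl T i) = cl T' (s i)) ->
  (forall k, k \in ex -> f (cl (mutate T k) k) = cl (mutate T' (s k)) (s k)) ->
  similar f s T T'.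
Proof.
move=> hf hs rT rT' hcl hmut; split=> // k hk.
have hT := reach_labeled hS rT; have hT' := reach_labeled hS rT'.
have rTk : reach S (mutate T k) by apply: reach_step; rewrite // (lseed_exs hT).
pose v i := bm T ((s^-1)%g i) k.
have e : exch (cl T') (fun j => bm T' j (s k)) = exch (cl T') v.
  rewrite -[RHS](exch_perm _ s) -mutate_mul // -hmut // -hcl.
  rewrite -(aut_mul hf); try exact: cl_CA.
  rewrite mutate_mul // (aut_exch (subalg_gen _) hf) => [|j]; last exact: cl_CA.
  by congr exch; apply: functional_extensionality => i; rewrite ?hcl // /v permK.
have [h|h] := exch_inj (lseed_free hT') e; [left|right] => i; by rewrite h /v permK.
Qed.

Lemma similar_mutate f (s : {perm 'I_m}) T T' k : alg_aut (CA S) f ->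
  (forall i, (s i \in ex) = (i \in ex)) ->
  similar f s T T' -> k \in ex -> similar f s (mutate T k) (mutate T' (s k)).
Proof.
move=> hf hs [rT rT' hcl hbm] hk.
have hT := reach_labeled hS rT; have hT' := reach_labeled hS rT'.
have rTk : reach S (mutate T k) by apply: reach_step; rewrite // (lseed_exs hT).
have rTk' : reach S (mutate T' (s k)).
  by apply: reach_step; rewrite // (lseed_exs hT') hs.
split=> // [i|j hj].
  rewrite [RHS]cl_mutate ?(lseed_Vs hT') // (inj_eq perm_inj).
  have [->|ni] := eqVneq i k; last by rewrite cl_mutate ?(lseed_Vs hT) // (negPf ni).
  apply: (canRL (mulfK (cl_neq0 _ hT'))).
  rewrite -hcl -(aut_mul hf); try exact: cl_CA.
  rewrite mutate_mul // (aut_exch (subalg_gen _) hf) => [|j]; last exact: cl_CA.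
  rewrite -[RHS](exch_perm _ s).
  have -> : (fun j => f (cl T j)) = (fun j => cl T' (s j)).
    by apply: functional_extensionality.
  (* Either sign of column [k] yields the same exchange binomial. *)
  have [h|h] := hbm _ hk; last rewrite -[LHS]exch_opp; congr exch;
    by apply: functional_extensionality => j; rewrite h.
rewrite /= /mut_matrix.
have [d1 [d1_gt0 sk1]] := lseed_skew hT; have [d2 [d2_gt0 sk2]] := lseed_skew hT'.
have := sk1 _ _ hk hj; have := d1_gt0 j; have := d1_gt0 k.
have /= := sk2 (s k) (s j); rewrite !hs => /(_ hk hj).
have := d2_gt0 (s j); have := d2_gt0 (s k).
(* Each column [j] keeps its sign. If columns [k] and [j] carry opposite signs, the two
   skew-symmetrizability relations force [bm T k j] to vanish, and the correction terms of the
   mutation with it. *)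
have [hk1|hk1] := hbm _ hk; have [hj1|hj1] := hbm _ hj;
  rewrite hk1 hj1 => a1 a2 a3 a4 a5 a6.
- by left=> i; rewrite !(inj_eq perm_inj) !hk1 !hj1.
- have b0 : bm T k j = 0 by clear -a1 a2 a3 a4 a5 a6; nia.
  right=> i; rewrite !(inj_eq perm_inj) !hk1 !hj1 b0 oppr0 mulr0 maxxx mulr0 !addr0.
  by case: ifP.
- have b0 : bm T k j = 0 by clear -a1 a2 a3 a4 a5 a6; nia.
  left=> i; rewrite !(inj_eq perm_inj) !hk1 !hj1 b0 !mulr0 ?maxxx ?mulr0 ?addr0.
  by case: ifP.
- right=> i; rewrite !(inj_eq perm_inj) !hk1 !hj1 mulrNN sgrN.
  by case: ifP => _ //; rewrite mulNr opprD.
Qed.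

Lemma cluster_aut_cl f : cluster_aut S f -> exists s : {perm 'I_m},
  (forall i, (s i \in ex) = (i \in ex)) /\
  forall T, reach S T -> exists2 T', reach S T' & forall i, f (cl T i) = cl T' (s i).
Proof.
move=> hf; have hA := cluster_aut_alg hf.
case: hf => _ [T1 [T2 [s [r1 [r2 [hs [hcl hmut]]]]]]].
have hs' : forall i, (s i \in ex) = (i \in ex) by move=> i; rewrite -(lseed_exs hS).
exists s; split=> // T rT.
have sim0 : similar f s T1 T2.
  by apply: similar_of_exch => // k; rewrite -(lseed_exs hS); apply: hmut.
have hT1 := reach_labeled hS r1.
have [T' [_ rT' hT' _]] : exists T', similar f s T T'; last by exists T'.
(* Mutations are reversible, so [T] is reached from [T1] through [S], and the similarity of [T1] and
   [T2] is carried along this path. *)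
elim: (reach_trans (reach_sym hS r1) rT) => [|U k rU [U' sU] hk]; first by exists T2.
exists (mutate U' (s k)); apply: similar_mutate => //.
by rewrite -(lseed_exs (reach_labeled hT1 rU)).
Qed.

Lemma cluster_aut_ext_var f x : cluster_aut S f -> ext_var S x -> ext_var S (f x).
Proof.
move=> /cluster_aut_cl[s [_ h]] [T [i [rT [hi ->]]]].
have [T' rT' ->] := h _ rT; exists T', (s i).
by rewrite (lseed_Vs hS) inE.
Qed.

Lemma cluster_aut_frozen_var f x :
  cluster_aut S f -> frozen_var S x -> frozen_var S (f x).
Proof.
move=> /cluster_aut_cl[s [hs h]] [i [hi [ni ->]]].
have [T' rT' ->] := h _ (reach_refl S); exists (s i).
have ni' : s i \notin exs S by rewrite (lseed_exs hS) hs -(lseed_exs hS).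
by rewrite (lseed_Vs hS) inE; split=> //; split=> //; apply: frozen_cl.
Qed.
End ClusterAut.

(** * Specializing variables to rational numbers *)

Lemma rmorph_mpoly_eq (n : nat) (R : comNzRingType) (S : nzRingType)
    (f g : {rmorphism {mpoly R[n]} -> S}) :
  (forall a, f a%:MP = g a%:MP) -> (forall i, f 'X_i = g 'X_i) -> f =1 g.
Proof.
move=> hC hX; elim/mpoly_ring_ind => // p q ihp ihq.
  by rewrite !rmorphD ihp ihq.
by rewrite !rmorphM ihp ihq.
Qed.

Section Specialization.
Variable m : nat.
Local Notation MP := {mpoly rat[m]}.
Implicit Types (P Q : MP) (J : {set 'I_m}) (y : 'I_m -> rat).

(** An idempotent endomorphism whose fixed points are the polynomials free of the variables in
    [J]. *)
Definition spec J y : MP -> MP :=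
  mmap (@mpolyC m rat) (fun i => if i \in J then (y i)%:MP else 'X_i).

HB.instance Definition _ J y := GRing.RMorphism.copy (spec J y)
  (mmap (@mpolyC m rat) (fun i => if i \in J then (y i)%:MP else 'X_i)).

Lemma specC J y q : spec J y q%:MP = q%:MP.
Proof. by rewrite /spec mmapC. Qed.

Lemma specX J y i : spec J y 'X_i = if i \in J then (y i)%:MP else 'X_i.
Proof. by rewrite /spec mmapX mmap1U. Qed.

Lemma spec_id J y P : spec J y (spec J y P) = spec J y P.
Proof.
apply: (rmorph_mpoly_eq (f := spec J y \o spec J y) (g := spec J y)) => [q|i] /=.
  by rewrite !specC.
by rewrite specX; case: ifP => hi; rewrite ?specC // specX hi.
Qed.

Lemma spec1_neq0 i Q : Q != 0 -> exists t, spec [set i] (fun=> t) Q != 0.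
Proof.
move=> nQ.
(* [phi] reads a polynomial as one in the single variable ['X_i], with the other variables in the
   coefficients. As [phi Q] has fewer roots than its size, one of that many naturals is not a
   root. *)
pose phi : {rmorphism MP -> {poly MP}} := mmap (polyC \o @mpolyC m rat)
  (fun j => if j == i then 'X else ('X_j)%:P).
have phiC q : phi q%:MP = (q%:MP)%:P by rewrite /phi /= mmapC.
have phiX j : phi 'X_j = if j == i then 'X else ('X_j)%:P.
  by rewrite /phi /= mmapX mmap1U.
have phi_i P : (phi P).['X_i] = P.
  apply: (rmorph_mpoly_eq (f := horner_eval 'X_i \o phi) (g := idfun)) => [q|j] /=.
    by rewrite phiC /horner_eval hornerC.
  by rewrite phiX /horner_eval; case: eqP => [->|_]; rewrite ?hornerX ?hornerC.
have phi_t t P : (phi P).[t%:MP] = spec [set i] (fun=> t) P.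
  apply: (rmorph_mpoly_eq (f := horner_eval (t%:MP) \o phi)
                          (g := spec [set i] (fun=> t))) => [q|j] /=.
    by rewrite phiC /horner_eval hornerC specC.
  by rewrite phiX specX inE /horner_eval; case: ifP; rewrite ?hornerX ?hornerC.
have np : phi Q != 0.
  by apply: contraNneq nQ => p0; rewrite -(phi_i Q) p0 horner0.
pose rs : seq MP := [seq (n%:R)%:MP | n <- seq.iota 0 (size (phi Q))].
have urs : uniq rs.
  rewrite map_inj_uniq ?seq.iota_uniq // => a b /eqP; rewrite mpolyC_eq eqr_nat.
  by move/eqP.
have /allPn[_ /mapP[n _ ->]] : ~~ all (root (phi Q)) rs.
  by apply/negP => /(max_poly_roots np) /(_ urs); rewrite size_map size_iota ltnn.
by rewrite rootE phi_t => h; exists n%:R.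
Qed.

Lemma spec_neq0 J Q : Q != 0 -> exists y, spec J y Q != 0.
Proof.
move=> nQ; have -> : J = [set i in enum J] by apply/setP => i; rewrite !inE mem_enum.
elim: (enum J) => [|i r [y hy]].
  exists (fun=> 0); suff -> : spec [set i in [::]] (fun=> 0) Q = Q by [].
  apply: (rmorph_mpoly_eq (g := idfun)) => [q|j] /=; first by rewrite specC.
  by rewrite specX inE.
have [t ht] := spec1_neq0 i hy.
pose y' j := if j \in r then y j else t; exists y'.
suff -> : spec [set j in i :: r] y' Q =
    spec [set i] (fun=> t) (spec [set j in r] y Q) by [].
apply: (rmorph_mpoly_eq
  (g := spec [set i] (fun=> t) \o spec [set j in r] y)) => [q|j] /=.
  by rewrite !specC.
rewrite !specX !inE /y'; case: (j \in r); first by rewrite specC orbT.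
by rewrite specX inE orbF.
Qed.

Variables (K : fieldType) (iota : {rmorphism rat -> K}) (c : 'I_m -> K).
Hypothesis hc : free_gens iota c.
Local Notation ev := (ev iota c).

(** The subfield generated by the [c i] with [i] outside [J], whatever the values [y]. *)
Definition base_field J y (x : K) : Prop :=
  frac_of iota c (fun P => spec J y P = P) x.

Lemma base_field_subalg J y : subalg (base_field J y).
Proof.
have hC : forall q, spec J y q%:MP = q%:MP by move=> q; rewrite specC.
have hD P Q : spec J y P = P -> spec J y Q = Q -> spec J y (P + Q) = P + Q.
  by move=> e1 e2; rewrite rmorphD /= e1 e2.
have hM P Q : spec J y P = P -> spec J y Q = Q -> spec J y (P * Q) = P * Q.
  by move=> e1 e2; rewrite rmorphM /= e1 e2.
by split; [apply: frac_of_ratr|apply: frac_of_add|apply: frac_of_mul].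
Qed.

Lemma base_field_inv J y x : base_field J y x -> base_field J y x^-1.
Proof. by apply: frac_of_inv => q; rewrite specC. Qed.

Lemma base_field_gen J y i : i \notin J -> base_field J y (c i).
Proof.
move=> hi; rewrite -(evX iota c i); apply: frac_of_ev => [q|]; first by rewrite specC.
by rewrite specX (negPf hi).
Qed.

(** A substitution extends only to fractions whose denominator survives it, so it is encoded as a
    relation rather than a function. *)
Definition specializes J y (a b : K) : Prop := exists P Q,
  [/\ spec J y Q != 0, a = ev P / ev Q & b = ev (spec J y P) / ev (spec J y Q)].

Section Specializes.
Variables (J : {set 'I_m}) (y : 'I_m -> rat).

Lemma spec_ev_neq0 Q : spec J y Q != 0 -> ev Q != 0 /\ ev (spec J y Q) != 0.
Proof.
move=> nQ; split; last exact: ev_neq0.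
by apply: ev_neq0 => //; apply: contraNneq nQ => ->; rewrite rmorph0.
Qed.

Lemma specializes_add a b a' b' : specializes J y a b -> specializes J y a' b' ->
  specializes J y (a + a') (b + b').
Proof.
move=> [P [Q [nQ -> ->]]] [P' [Q' [nQ' -> ->]]].
have [n1 n2] := spec_ev_neq0 nQ; have [n1' n2'] := spec_ev_neq0 nQ'.
exists (P * Q' + P' * Q), (Q * Q'); split.
- by rewrite rmorphM mulf_neq0.
- by rewrite !rmorphD !rmorphM addf_div.
- by rewrite !rmorphD !rmorphM addf_div.
Qed.

Lemma specializes_mul a b a' b' : specializes J y a b -> specializes J y a' b' ->
  specializes J y (a * a') (b * b').
Proof.
move=> [P [Q [nQ -> ->]]] [P' [Q' [nQ' -> ->]]].
exists (P * P'), (Q * Q'); split.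
- by rewrite rmorphM mulf_neq0.
- by rewrite !rmorphM mulf_div.
- by rewrite !rmorphM mulf_div.
Qed.

Lemma specializes_base a : base_field J y a -> specializes J y a a.
Proof.
move=> [P [Q [hP hQ nQ ->]]]; exists P, Q; split; rewrite ?hP ?hQ //.
by apply: contraNneq nQ => ->; rewrite rmorph0.
Qed.

Lemma specializes0 b : specializes J y 0 b -> b = 0.
Proof.
move=> [P [Q [nQ /esym/eqP e ->]]]; have [n1 _] := spec_ev_neq0 nQ.
move: e; rewrite mulf_eq0 invr_eq0 (negPf n1) orbF => /eqP /(ev_inj0 hc) ->.
by rewrite !rmorph0 mul0r.
Qed.

Lemma specializes_horner (g : {poly K}) z w : (forall i, base_field J y g`_i) ->
  specializes J y z w -> specializes J y g.[z] g.[w].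
Proof.
move=> hg hzw; rewrite !horner_coef.
have hB q : specializes J y (ratr q) (ratr q).
  exact/specializes_base/(sub_rat (base_field_subalg J y)).
apply: (big_ind2 (specializes J y)).
- by have := hB 0; rewrite ratr0.
- by move=> *; apply: specializes_add.
move=> i _; apply: specializes_mul; first exact: specializes_base.
elim: (val i) => [|n ih]; first by have := hB 1; rewrite ratr1.
by rewrite !exprS; apply: specializes_mul.
Qed.
End Specializes.

(* Specializing the variables in [J] to suitable rationals turns a root of [g]
   into a root lying in the field of coefficients. *)
Lemma root_in_base_field J (g : {poly K}) z :
  (forall y i, base_field J y g`_i) -> g.[z] = 0 ->
  exists y, exists2 w, g.[w] = 0 & base_field J y w.
Proof.
move=> hg gz; have [P [Q [_ _ nQ ez]]] := ev_frac hc z.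
have nQ' : Q != 0 by apply: contraNneq nQ => ->; rewrite rmorph0.
(* The only genericity asked of [y] is that the denominator of [z] survives. *)
have [y ny] := spec_neq0 J nQ'.
pose w := ev (spec J y P) / ev (spec J y Q); exists y, w.
  apply: (@specializes0 J y); rewrite -gz; apply: specializes_horner => //.
  by exists P, Q.
exists (spec J y P), (spec J y Q); split; rewrite ?spec_id //.
exact: ev_neq0.
Qed.

Lemma ev_spec_sub (A : K -> Prop) J y P : subalg A ->
  (forall i, i \notin J -> A (c i)) -> spec J y P = P -> A (ev P).
Proof.
move=> hA hX <-.
elim/mpoly_ring_ind: P => [q|i|p q ihp ihq|p q ihp ihq].
- by rewrite specC evC; apply: (sub_rat hA).
- rewrite specX; case: ifPn => hi; last by rewrite evX; apply: hX.
  by rewrite evC; apply: (sub_rat hA).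
- by rewrite !rmorphD; apply: (sub_add hA).
- by rewrite !rmorphM; apply: (sub_mul hA).
Qed.
End Specialization.

(** * Finite orbits, orbit polynomials and bases stable under a group *)

Record aut_group (K : fieldType) (A : K -> Prop) (H : (K -> K) -> Prop) : Prop :=
  AutGroup {
  group_aut : forall f, H f -> alg_aut A f;
  group_id : H id;
  group_comp : forall f g, H f -> H g -> H (f \o g);
  group_inv : forall f, H f -> exists2 g, H g & forall a, A a -> g (f a) = a }.

Definition propb (P : Prop) : bool :=
  if excluded_middle_informative P then true else false.

Lemma propbP (P : Prop) : reflect P (propb P).
Proof. by rewrite /propb; case: excluded_middle_informative => h; constructor. Qed.

Section AutGroup.
Variables (K : fieldType) (iota : {rmorphism rat -> K}).
Variables (A : K -> Prop) (H : (K -> K) -> Prop).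
Hypotheses (hA : subalg A) (hH : aut_group A H).

Lemma orbit_poly z (s : seq K) : A z -> (forall f, H f -> f z \in s) ->
  exists o : seq K, let g : {poly K} := \prod_(x <- o) ('X - x%:P) in
  [/\ z \in o, forall x, x \in o -> exists2 f, H f & x = f z,
      forall i, A g`_i & forall f i, H f -> f g`_i = g`_i].
Proof.
(* The list [s] only bounds the orbit; classical filtering cuts it down to the orbit exactly,
   without repetitions. *)
move=> Az hs; pose o := [seq x <- undup s | propb (exists2 f, H f & x = f z)].
have ho x : x \in o -> exists2 f, H f & x = f z.
  by rewrite mem_filter => /andP[/propbP].
have ho' f : H f -> f z \in o.
  move=> hf; rewrite mem_filter mem_undup hs // andbT; apply/propbP.
  by exists f.
have Ao x : x \in o -> A x.
  by move=> /ho[f /(group_aut hH) hf ->]; apply: (aut_closed hf).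
exists o => g; split=> //; first exact: (ho' id (group_id hH)).
  exact: (coef_prod_XsubC_gen hA Ao).
move=> f i hf; have hfa := group_aut hH hf.
rewrite -(coef_map_id0 _ _ (aut0 hA hfa)) (aut_prod_XsubC hA hfa Ao).
(* [f] is injective on [A] and maps the finite orbit into itself, so it permutes the roots. *)
suff pe : perm_eq (map f o) o by rewrite (perm_big _ pe).
have uo : uniq o by rewrite filter_uniq ?undup_uniq.
have um : uniq (map f o).
  by rewrite map_inj_in_uniq // => a b /Ao ha /Ao hb; apply: (aut_inj hfa).
apply: uniq_perm => //.
have sub : {subset map f o <= o}.
  move=> _ /mapP[x /ho[h hh ->] ->].
  exact: (ho' _ (group_comp hH hf hh)).
by have [] := uniq_min_size um sub; rewrite ?size_map.
Qed.

(** [f] is multiplicative on [A] only, so it is applied to [w * q = p], whose terms all lie in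
    [A]. *)
Lemma aut_frac p q w f : H f -> A p -> A q -> A w -> q != 0 -> w = p / q ->
  f p = p -> f q = q -> f w = w.
Proof.
move=> hf Ap Aq Aw nq e fp fq; apply: (mulIf nq).
by rewrite -{1}fq -(aut_mul (group_aut hH hf)) // e divfK.
Qed.

Section Basis.
Variable W : K -> Prop.
Hypothesis W_sub : forall w, W w -> A w.
Hypothesis W_free : forall (s : seq K) (d : K -> rat), uniq s ->
  (forall w, w \in s -> W w) -> \sum_(w <- s) ratr (d w) * w = 0 ->
  forall w, w \in s -> d w = 0.

(** Regrouping by the value of [f] produces a combination of distinct elements, the form to which
    linear independence applies. *)
Lemma sum_fibers (s t : seq K) (d : K -> rat) (f : K -> K) : uniq t ->
  (forall w, w \in s -> f w \in t) ->
  \sum_(v <- t) iota (\sum_(w <- s | f w == v) d w) * v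
  = \sum_(w <- s) iota (d w) * f w.
Proof.
move=> ut hst.
transitivity (\sum_(v <- t) \sum_(w <- s | f w == v) iota (d w) * f w).
  apply: eq_bigr => v _; rewrite rmorph_sum mulr_suml.
  by apply: eq_bigr => w /eqP ->.
rewrite (exchange_big_dep predT) //=.
rewrite big_seq [RHS]big_seq; apply: eq_bigr => w ws.
rewrite -big_filter (_ : [seq v <- t | f w == v] = [:: f w]) ?big_seq1 //.
rewrite -(filter_pred1_uniq ut (hst _ ws)).
by apply: eq_filter => v; rewrite /= eq_sym.
Qed.

(** Subtracting the image of the fixed element from it gives a relation between basis elements. If
    [f w0] left the support, its coefficient there would be [- d w0], by injectivity of [f],
    contradicting independence. *)
Lemma support_stable (f : K -> K) (s : seq K) (d : K -> rat) :
  alg_aut A f -> (forall w, W w -> W (f w)) -> uniq s ->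
  (forall w, w \in s -> W w) -> (forall w, w \in s -> d w != 0) ->
  f (\sum_(w <- s) ratr (d w) * w) = \sum_(w <- s) ratr (d w) * w ->
  forall w, w \in s -> f w \in s.
Proof.
move=> hf fW us sW nd fz w0 w0s; apply/negPn/negP => fw0.
have hA' w : w \in s -> A w by move=> ws; apply/W_sub/sW.
pose t := undup (s ++ map f s).
have ut : uniq t := undup_uniq _.
pose e v := \sum_(w <- s | w == v) d w - \sum_(w <- s | f w == v) d w.
have tW w : w \in t -> W w.
  rewrite mem_undup mem_cat => /orP[/sW//|/mapP[x xs ->]].
  exact/fW/sW.
have ft0 : f w0 \in t by rewrite mem_undup mem_cat map_f ?orbT.
have e0 : \sum_(v <- t) ratr (e v) * v = 0.
  transitivity (\sum_(v <- t) iota (\sum_(w <- s | id w == v) d w) * v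
                - \sum_(v <- t) iota (\sum_(w <- s | f w == v) d w) * v).
    rewrite -sumrB; apply: eq_bigr => v _.
    by rewrite -(fmorph_eq_rat iota) rmorphB mulrBl.
  rewrite !sum_fibers // => [|w ws|w ws]; last first.
  - by rewrite mem_undup mem_cat ws.
  - by rewrite mem_undup mem_cat map_f ?orbT.
  apply/eqP; rewrite subr_eq0; apply/eqP.
  under eq_bigr do rewrite fmorph_eq_rat; under [RHS]eq_bigr do rewrite fmorph_eq_rat.
  rewrite -fz (aut_sum hA hf) => [|w ws _]; last first.
    by apply: (sub_mul hA); [apply: (sub_rat hA)|apply: hA'].
  rewrite big_seq [RHS]big_seq; apply: eq_bigr => w ws.
  by rewrite (aut_scale hf) //; apply: hA'.
have := W_free ut tW e0 ft0.
rewrite /e big_seq_cond big1 => [|w /andP[ws /eqP ew]]; last by rewrite -ew ws in fw0.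
rewrite big_seq_cond (eq_bigl (fun w => (w \in s) && (w == w0))) => [|w]; last first.
  case ws : (w \in s) => //=; apply/eqP/eqP => [|-> //].
  by apply: (aut_inj hf); apply: hA'.
rewrite -big_seq_cond -big_filter filter_pred1_uniq // big_seq1 sub0r => /eqP.
by rewrite oppr_eq0 (negPf (nd _ w0s)).
Qed.

Hypothesis W_span : forall a, A a -> exists s : seq K, exists d : K -> rat,
  uniq s /\ (forall w, w \in s -> W w) /\ a = \sum_(w <- s) ratr (d w) * w.
Hypothesis W_stable : forall f w, H f -> W w -> W (f w).

Lemma fixed_in_subalg (B : K -> Prop) z : subalg B ->
  (forall w, W w -> (exists s : seq K, forall f, H f -> f w \in s) -> B w) ->
  A z -> (forall f, H f -> f z = z) -> B z.
Proof.
move=> hB hW Az fz; have [s0 [d [us0 [s0W ez]]]] := W_span Az.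
pose s := [seq w <- s0 | d w != 0].
have us : uniq s by rewrite filter_uniq.
have sW w : w \in s -> W w by rewrite mem_filter => /andP[_ /s0W].
have nd w : w \in s -> d w != 0 by rewrite mem_filter => /andP[].
have {}ez : z = \sum_(w <- s) ratr (d w) * w.
  rewrite ez big_filter [RHS]big_mkcond; apply: eq_bigr => w _.
  by case: eqP => //= ->; rewrite ratr0 mul0r.
rewrite ez; apply: (sub_sum hB) => w ws _; apply: (sub_mul hB).
  exact: (sub_rat hB).
apply: hW; first exact: sW.
exists s => f hf; apply: (@support_stable f s d) => //.
- exact: (group_aut hH).
- by move=> v; apply: W_stable.
- by rewrite -ez fz.
Qed.
End Basis.

Section Factors.
(* [E w s]: the basis element [w] has factors [s]. *)
Variable E : K -> seq K -> Prop.
Hypothesis E_uniq : forall w s1 s2, E w s1 -> E w s2 -> perm_eq s1 s2.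
Hypothesis E_stable : forall f w s, H f -> E w s -> E (f w) (map f s).

(** By uniqueness up to order, one factorization per member of [t] suffices; members without
    factorization contribute nothing. *)
Lemma factor_bound (t : seq K) :
  exists L : seq K, forall w s, w \in t -> E w s -> {subset s <= L}.
Proof.
elim: t => [|v t [L hL]]; first by exists [::].
have [[s0 hs0]|no] := excluded_middle_informative (exists s, E v s).
  exists (s0 ++ L) => w s; rewrite inE => /orP[/eqP -> hs|wt hs] x xs; rewrite mem_cat.
    by rewrite -(perm_mem (E_uniq hs hs0)) xs.
  by rewrite (hL _ _ wt hs) ?orbT.
exists L => w s; rewrite inE => /orP[/eqP -> hs|]; last exact: hL.
by case: no; exists s.
Qed.

(** An image of [x] is a factor of an image of [w], and the latter images are finite in number. *)
Lemma factor_orbit w s : E w s -> (exists t : seq K, forall f, H f -> f w \in t) ->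
  forall x, x \in s -> exists t : seq K, forall f, H f -> f x \in t.
Proof.
move=> hw [t ht] x xs; have [L hL] := factor_bound t; exists L => f hf.
by apply: (hL _ _ (ht _ hf) (E_stable hf hw)); apply: map_f.
Qed.
End Factors.
End AutGroup.

Lemma not_infinite_orbit (m : nat) (H : (F m -> F m) -> Prop) z :
  ~ infinite_orbit H z -> exists s : seq (F m), forall f, H f -> f z \in s.
Proof.
move=> h; apply: NNPP => h'; apply: h => s.
apply: NNPP => h''; apply: h'; exists s => f hf.
by apply/negPn/negP => nf; apply: h''; exists f.
Qed.

Lemma subgroup_aut_group (m : nat) (S : seed m) H :
  subgroup_aut S H -> aut_group (CA S) H.
Proof.
case=> h1 h2 h3 h4; split=> // [f /h1|f /h4[g hg h]]; first exact: cluster_aut_alg.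
by exists g => // a /h[].
Qed.

(** * Elements of finite orbit when the invariants form a cluster subalgebra *)

Section Subseed.
Variables (m : nat) (ex : {set 'I_m}) (S S0 : seed m) (I0 I1 : {set 'I_m}).
Hypotheses (hS : labeled_seed ex S) (rS0 : reach S S0).
Local Notation S1 := (subseed S0 I0 I1).

Let hS0 : labeled_seed ex S0 := reach_labeled hS rS0.

(** Mutations of the sub-seed are field operations on the variables that were not deleted. *)
Lemma subseed_base_field y z : CA S1 z -> base_field (ratF m) (cl S0) I1 y z.
Proof.
pose B := base_field (ratF m) (cl S0) I1 y.
have hB : subalg B by exact: base_field_subalg.
have hcl T : reach S1 T -> Vs T = Vs S1 /\ forall i, i \in Vs S1 -> B (cl T i).
  elim=> [|{}T k _ [hV ih] _]; split=> // i hi.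
    by apply: base_field_gen; move: hi; rewrite /= inE => /andP[].
  rewrite /=; case: eqP => [eik|_]; last exact: ih.
  apply: (sub_mul hB); last by apply: base_field_inv; rewrite -eik; apply: ih.
  by apply: (sub_add hB); apply: (sub_prod hB) => j _; rewrite hV => /andP[hj _];
    apply: (sub_exp hB); apply: ih.
move: z; apply: gen_incl; [exact: sub_rat|exact: sub_add|exact: sub_mul|].
by move=> _ [T [i [rT [hi ->]]]]; apply: (hcl T rT).2.
Qed.

(** Lets invariance be checked on numerator and denominator. *)
Lemma base_field_quotient y w : base_field (ratF m) (cl S0) I1 y w ->
  exists p q, [/\ CA S1 p, CA S1 q, q != 0 & w = p / q].
Proof.
move=> [P [Q [hP hQ nQ ->]]].
exists (ev (ratF m) (cl S0) P), (ev (ratF m) (cl S0) Q).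
have hX i : i \notin I1 -> CA S1 (cl S0 i).
  move=> hi; apply: gen_var; exists S1, i; split; first exact: reach_refl.
  by rewrite /= inE hi (lseed_Vs hS0) inE.
by split=> //; [apply: (ev_spec_sub _ _ hX hP)|apply: (ev_spec_sub _ _ hX hQ)];
  exact: subalg_gen.
Qed.

Lemma finite_orbit_in_subseed H (s : seq (F m)) z : aut_group (CA S) H ->
  (forall x, invariants S H x <-> CA S1 x) -> CA S z ->
  (forall f, H f -> f z \in s) -> CA S1 z.
Proof.
move=> hH hinv Az hs; have hA := subalg_gen (ext_var S).
have [o [zo ho Ag fg]] := orbit_poly hA hH Az hs.
set g : {poly F m} := \prod_(x <- o) _ in Ag fg.
have rootg x : (g.[x] == 0) = (x \in o) by rewrite -rootE root_prod_XsubC.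
have gz : g.[z] = 0 by apply/eqP; rewrite rootg.
have hg y i : base_field (ratF m) (cl S0) I1 y g`_i.
  by apply/subseed_base_field/hinv; split=> // f; apply: fg.
have [y [w gw hw]] := root_in_base_field (lseed_free hS0) hg gz.
have [h hh ew] : exists2 f, H f & w = f z by apply/ho; rewrite -rootg gw.
have [p [q [hp hq nq epq]]] := base_field_quotient hw.
have [[Ap fp] [Aq fq]] := (proj2 (hinv p) hp, proj2 (hinv q) hq).
have Aw : CA S w by rewrite ew; apply: (aut_closed (group_aut hH hh)).
have fw f : H f -> f w = w.
  by move=> hf; apply: (aut_frac hH hf Ap Aq Aw nq epq); [apply: fp|apply: fq].
have [h' hh' hK] := group_inv hH hh.
(* The inverse of [h] fixes [w] and also sends it back to [z]. *)
have -> : z = w by rewrite -(hK _ Az) -ew; apply: fw.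
by apply/hinv.
Qed.
End Subseed.

(** * Invariants expanded in a stable basis *)

Section Bases.
Variables (m : nat) (ex : {set 'I_m}) (S : seed m) (H : (F m -> F m) -> Prop).
Hypotheses (hS : labeled_seed ex S) (hH : subgroup_aut S H).
Variable B : F m -> Prop.
Hypothesis hB : subalg B.

Let hG := subgroup_aut_group hH.
Let hA := subalg_gen (ext_var S).
Let H_aut f : H f -> cluster_aut S f. Proof. by case: hH => h _ _ _ /h. Qed.

Lemma map_uniq_aut f (s : seq (F m)) : H f -> uniq s ->
  (forall x, x \in s -> CA S x) -> uniq (map f s).
Proof.
move=> hf us hs; rewrite map_inj_in_uniq // => a b /hs ha /hs hb.
exact: (aut_inj (group_aut hG hf)).
Qed.

Lemma monomial_basis_fixed W z : stable_monomial_basis_unique S W ->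
  (forall x, ext_var S x ->
     (exists s : seq (F m), forall f, H f -> f x \in s) -> B x) ->
  CA S z -> (forall f, H f -> f z = z) -> B z.
Proof.
move=> [[W_sub W_free W_span] W_mon W_stab W_uniq] hx.
have W_stable f w : H f -> W w -> W (f w) by move=> /H_aut; apply: W_stab.
apply: (fixed_in_subalg (ratF m) hA hG W_sub W_free W_span W_stable hB) => w Ww fin.
have [s [k hsk]] := W_mon _ Ww; have [us hs ew] := hsk.
pose E w s := W w /\ exists k, monomial_expr S w s k.
have E_uniq v s1 s2 : E v s1 -> E v s2 -> perm_eq s1 s2.
  by move=> [Wv [k1 h1]] [_ [k2 h2]]; apply: (W_uniq v s1 k1 s2 k2).
have E_stable f v t : H f -> E v t -> E (f v) (map f t).
  move=> hf [Wv [l [ut ht ev]]]; split; first exact: W_stable.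
  have ht' x : x \in t -> CA S x by move=> /ht[hx' _]; apply: gen_var.
  have [g _ gK] := group_inv hG hf.
  (* Exponents are indexed by the factors themselves, so those of [f v] are pulled back through the
     inverse [g] of [f]. *)
  exists (fun x => l (g x)); split; first exact: map_uniq_aut.
    move=> _ /mapP[x xt ->]; have [hx' kx] := ht _ xt.
    rewrite gK; last exact: ht'.
    by split=> //; apply: (cluster_aut_ext_var hS) => //; apply: H_aut.
  rewrite ev (aut_prod hA (group_aut hG hf)) => [|x xt _]; last first.
    by apply: (sub_exp hA); apply: ht'.
  rewrite big_map; apply: eq_big_seq => x xt.
  by rewrite (aut_exp hA (group_aut hG hf)) ?gK //; apply: ht'.
have Ew : E w s by split=> //; exists k.
rewrite ew; apply: (sub_prod hB) => x xs _; apply: (sub_exp hB).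
by apply: hx; [case: (hs _ xs)|apply: (factor_orbit E_uniq E_stable Ew fin)].
Qed.

(** The images are again frozen variables, of which there are finitely many. *)
Lemma frozen_finite_orbit x : frozen_var S x ->
  exists s : seq (F m), forall f, H f -> f x \in s.
Proof.
move=> hx; exists [seq cl S i | i : 'I_m] => f /H_aut hf.
by have [i [_ [_ ->]]] := cluster_aut_frozen_var hS hf hx; apply: image_f.
Qed.

Lemma Dstable_basis_fixed Cq D P z : Dstable_basis S Cq D P ->
  (forall x, ext_var S x \/ Cq x ->
     (exists s : seq (F m), forall f, H f -> f x \in s) -> B x) ->
  CA S z -> (forall f, H f -> f z = z) -> B z.
Proof.
move=> [hCq [hP [hDU [_ [hbr [hDf [[W_sub W_free W_span] hD_uniq]]]]]]] hx.
pose W w := exists U s k, D U /\ Dprod S P U s k w.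
have frozen_ext x : frozen_var S x -> ext_var S x.
  by move=> [i [hi [_ ->]]]; exists S, i; split; [apply: reach_refl|].
have frozenB x : frozen_var S x -> B x.
  by move=> fx; apply: hx; [left; apply: frozen_ext|apply: frozen_finite_orbit].
have bracket_sub (A : F m -> Prop) k x :
    subalg A -> (forall a, frozen_var S a -> A a) -> A x -> A (bracket S P k x).
  move=> hA' frA Ax; rewrite /bracket; case: excluded_middle_informative => ? /=.
    exact: sub_exp.
  apply: (sub_horner hA') => // i; move: (hP k i); apply: gen_incl => //.
  - exact: (sub_rat hA').
  - exact: (sub_add hA').
  - exact: (sub_mul hA').
have frozenA x : frozen_var S x -> CA S x by move=> /frozen_ext; apply: gen_var.
have U_A U x : D U -> U x -> CA S x.
  by move=> DU Ux; case: (hDU U DU x Ux) => [/hCq[]|] // ?; apply: gen_var.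
(* The set [U] is left existential, as uniqueness holds across all members of [D]. *)
pose E w s := exists U k, D U /\ Dprod S P U s k w.
have E_uniq v s1 s2 : E v s1 -> E v s2 -> perm_eq s1 s2.
  move=> [U1 [k1 [D1 h1]]] [U2 [k2 [D2 h2]]].
  exact: (hD_uniq U1 U2 s1 s2 k1 k2 v).
have E_stable f v t : H f -> E v t -> E (f v) (map f t).
  move=> hf [U [l [DU [ut ht ev]]]].
  have [U2 DU2 hU2] := hDf f U (H_aut hf) DU.
  have ht' x : x \in t -> CA S x by move=> /ht[hx' _]; apply: (U_A U).
  have [g _ gK] := group_inv hG hf.
  exists U2, (fun x => l (g x)); split=> //; split; first exact: map_uniq_aut.
    move=> _ /mapP[x xt ->]; have [hx' kx] := ht _ xt.
    rewrite gK; last exact: ht'.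
    by split=> //; apply/hU2; exists x.
  rewrite ev (aut_prod hA (group_aut hG hf)) => [|x xt _]; last first.
    by apply: bracket_sub => //; apply: ht'.
  rewrite big_map; apply: eq_big_seq => x xt; have [Ux kx] := ht _ xt.
  by rewrite (hbr f U) ?gK //; [apply: ht'|apply: H_aut].
have W_stable f w : H f -> W w -> W (f w).
  move=> hf [U [s [k [DU hw]]]].
  have [U2 [k2 [D2 h2]]] : E (f w) (map f s) by apply: E_stable => //; exists U, k.
  by exists U2, (map f s), k2.
apply: (fixed_in_subalg (W := W) (ratF m) hA hG W_sub W_free W_span W_stable hB).
move=> w [U [s [k [DU hw]]]] fin; have [us hs ew] := hw.
have Ew : E w s by exists U, k.
rewrite ew; apply: (sub_prod hB) => x xs _; apply: bracket_sub => //.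
apply: hx; last exact: (factor_orbit E_uniq E_stable Ew fin).
by have [Ux _] := hs _ xs; case: (hDU U DU x Ux) => ?; [right|left].
Qed.
End Bases.

(** * Invariant algebras characterized by infinite orbits *)

Theorem theoremB (m : nat) (ex : {set 'I_m}) (b : 'I_m -> 'I_m -> int)
  (hskew : skew_symmetrizable ex b)
  (H : (F m -> F m) -> Prop) (hH : subgroup_aut (Sigma ex b) H)
  (S1 : seed m) (hS1 : cluster_subseed (Sigma ex b) S1)
  (hinv : forall z, CA S1 z -> invariants (Sigma ex b) H z)
  (hmax : forall S', cluster_subseed (Sigma ex b) S' ->
            (forall z, CA S1 z -> CA S' z) ->
            (forall z, CA S' z -> invariants (Sigma ex b) H z) ->
            forall z, CA S' z -> CA S1 z) :
  ((forall z, invariants (Sigma ex b) H z <-> CA S1 z) ->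
     forall z, CA (Sigma ex b) z -> ~ CA S1 z -> pos_laurent (Sigma ex b) z ->
       infinite_orbit H z)
  /\
  (((exists W, stable_monomial_basis_unique (Sigma ex b) W) /\
      (forall z, ext_var (Sigma ex b) z -> ~ CA S1 z -> infinite_orbit H z))
   \/
   (exists Cq D P, Dstable_basis (Sigma ex b) Cq D P /\
      (forall z, (ext_var (Sigma ex b) z \/ Cq z) -> ~ CA S1 z -> infinite_orbit H z))
   -> forall z, invariants (Sigma ex b) H z <-> CA S1 z).
Proof.
have hS := labeled_seed_Sigma hskew.
split=> [hfix z Az nz _|hyp z].
  apply: NNPP => /not_infinite_orbit[s hs]; apply: nz.
  case: hS1 => S0 [I0 [I1 [rS0 [_ [_ [_ [_ eS1]]]]]]]; rewrite eS1 in hfix *.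
  exact: (finite_orbit_in_subseed hS rS0 (subgroup_aut_group hH) hfix Az hs).
have not_infinite x : (exists s : seq (F m), forall f, H f -> f x \in s) ->
    ~ infinite_orbit H x.
  by move=> [s hs] /(_ s)[f [/hs ->]].
split; last exact: hinv.
move=> [Az fz]; have hB := subalg_gen (ext_var S1).
case: hyp => [[[W hW] hx]|[Cq [D [P [hD hx]]]]].
  (* Contrapositively, the hypothesis puts every cluster variable of finite orbit into [CA S1],
     which serves as [B]. *)
  apply: (monomial_basis_fixed hS hH hB hW _ Az fz) => x ext_x /not_infinite fin.
  by apply: NNPP => nx; apply/fin/hx.
apply: (Dstable_basis_fixed hS hH hB hD _ Az fz) => x ext_x /not_infinite fin.
by apply: NNPP => nx; apply/fin/hx.
Qed.
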